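(* Let $E,J,R\in\mathbb{C}^{n,n}$ and $B\in\mathbb{C}^{n,m}$ with $E=E^H\ge 0$, $R=R^H\ge 0$, $J=-J^H$ and $B$ of full column rank (the coefficients of a port-Hamiltonian descriptor system $E\dot x=(J-R)x+Bu$, $y=B^Hx$). There exist matrices $K,F_S,F_H\in\mathbb{C}^{m,m}$ with $F_S=-F_S^H$ and $F_H=F_H^H$ such that the pair $(E+BKB^H,\;J+BF_SB^H-(R+BF_HB^H))$ is regular and of index at most one, and $E+BKB^H\ge 0$, $R+BF_HB^H\ge 0$, if and only if the following two conditions hold: (a) $\operatorname{rank}\begin{bmatrix}E & J-R & B\end{bmatrix}=n$; (b) $\operatorname{rank}\Big(\mathcal{T}_\infty^H(B)\,E\,\mathcal{S}_\infty\big(\mathcal{T}_\infty^H(\begin{bmatrix}E & B\end{bmatrix})(J-R)\big)\Big)=\operatorname{rank}\begin{bmatrix}E & B\end{bmatrix}-\operatorname{rank}(B)$. Moreover, if (a) and (b) hold, then for a given integer $r$ there exist matrices $K$, $F_S=-F_S^H$, $F_H=F_H^H$ in $\mathbb{C}^{m,m}$ such that $E+BKB^H\ge 0$, $R+BF_HB^H\ge 0$, the pair $(E+BKB^H,\;(J+BF_SB^H)-(R+BF_HB^H))$ is regular and has index at most one, and $\operatorname{rank}(E+BKB^H)=r$, if and only if $$\operatorname{rank}\begin{bmatrix}E & B\end{bmatrix}-\operatorname{rank}(B)\;\le\; r\;\le\;\operatorname{rank}\left(\mathcal{T}_\infty^H\!\left((J-R)\,\mathcal{S}_\infty\!\left(\begin{bmatrix}E\\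 B^H\end{bmatrix}\right)\right)\begin{bmatrix}E & B\end{bmatrix}\right).$$
   Context: $\mathbb{C}^{p,q}$ denotes the complex $p\times q$ matrices. $M\ge 0$ ($M>0$) means that $M$ is Hermitian positive semidefinite (positive definite). A pair $(E,A)$ of square matrices (identified with the pencil $\lambda E-A$) is regular if $\det(\lambda_0E-A)\ne 0$ for some $\lambda_0\in\mathbb{C}$. The index of a regular pair is the size of the largest Jordan block associated with the eigenvalue $\infty$ in its Kronecker (Weierstrass) canonical form, and is $0$ if $E$ is invertible. $\mathcal{S}_\infty(M)$ denotes a full column rank matrix whose columns span the right nullspace of $M$; $\mathcal{T}_\infty(M)$ denotes a full column rank matrix whose columns span the left nullspace of $M$ (so $\mathcal{T}_\infty(M)^HM=0$), and $\mathcal{T}_\infty^H(M)=(\mathcal{T}_\infty(M))^H$. Trivial nullspaces give empty matrices, which have rank $0$. *)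

(* Defs.v *)
From mathcomp Require Import all_boot all_order all_algebra.
From mathcomp Require Import reals complex.

Set Implicit Arguments.
Unset Strict Implicit.
Unset Printing Implicit Defensive.

Import Order.TTheory GRing.Theory Num.Theory.
Local Open Scope ring_scope.
Local Open Scope sesquilinear_scope.

(* The order of a numClosedFieldType is partial: 0 <= z says that z is real and
   nonnegative. *)
Definition psdmx (C : numClosedFieldType) (n : nat) (M : 'M[C]_n) : Prop :=
  M ^t* = M /\ forall x : 'cV[C]_n, 0 <= (x ^t* *m M *m x) 0 0.

(* S is a possible value of S_oo(M). The nullspace dimension k is determined by
   these two conditions; when it is 0, S is an empty matrix. *)
Definition right_null_basis (C : numClosedFieldType) (p q k : nat)
    (M : 'M[C]_(p, q)) (S : 'M[C]_(q, k)) : Prop :=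
  \rank S = k /\
  forall x : 'cV[C]_q, M *m x = 0 <-> exists y : 'cV[C]_k, x = S *m y.

(* T is a possible value of T_oo(M). *)
Definition left_null_basis (C : numClosedFieldType) (p q k : nat)
    (M : 'M[C]_(p, q)) (T : 'M[C]_(p, k)) : Prop :=
  \rank T = k /\
  forall x : 'cV[C]_p, x ^t* *m M = 0 <-> exists y : 'cV[C]_k, x = T *m y.

Definition regular_pair (C : numClosedFieldType) (n : nat) (E A : 'M[C]_n) : Prop :=
  exists l0 : C, \det (l0 *: E - A) != 0.

Definition jordan_block (C : numClosedFieldType) (a : C) (k : nat) : 'M[C]_k :=
  \matrix_(i, j) (if i == j then a else if i.+1 == j :> nat then 1 else 0).

(* P (l E - A) Q = diag(l I - J, l N - I), where J is the direct sum of the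
   Jordan blocks of sizes p i and eigenvalues a i (the finite eigenvalues), and
   N is the direct sum of the nilpotent Jordan blocks of sizes q j (the
   eigenvalue infinity). The identity eN only identifies the total size of the
   blocks with n. *)
Definition weierstrass_form (C : numClosedFieldType) (n : nat) (E A : 'M[C]_n)
    (s t : nat) (p : 'I_s -> nat) (a : 'I_s -> C) (q : 'I_t -> nat) : Prop :=
  exists (eN : (\sum_i p i + \sum_j q j)%N = n) (P Q : 'M[C]_n),
    [/\ P \in unitmx, Q \in unitmx,
        P *m E *m Q =
          castmx (eN, eN)
            (block_mx 1%:M 0 0 (\mxdiag_j jordan_block 0 (q j)))
      & P *m A *m Q =
          castmx (eN, eN)
            (block_mx (\mxdiag_i jordan_block (a i) (p i)) 0 0 1%:M)].

(* The maximum over an empty family of blocks is 0, which is the value for an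
   invertible E. Blocks of size 0 are allowed; they do not affect it. *)
Definition pencil_index (C : numClosedFieldType) (n : nat) (E A : 'M[C]_n)
    (k : nat) : Prop :=
  exists (s t : nat) (p : 'I_s -> nat) (a : 'I_s -> C) (q : 'I_t -> nat),
    weierstrass_form E A p a q /\ k = (\max_j q j)%N.

Definition regular_index_le1 (C : numClosedFieldType) (n : nat)
    (E A : 'M[C]_n) : Prop :=
  regular_pair E A /\ exists2 k : nat, pencil_index E A k & (k <= 1)%N.

(* Main.v *)
Require Import Defs.
From HB Require Import structures.
From mathcomp Require Import all_boot all_order all_algebra.
From mathcomp Require Import reals complex.
From mathcomp Require Import zify ring.

Set Implicit Arguments.
Unset Strict Implicit.
Unset Printing Implicit Defensive.

Import Order.TTheory GRing.Theory Num.Theory.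
Local Open Scope ring_scope.
Local Open Scope sesquilinear_scope.

(** In a basis in which B = [I; 0], E = diag(E1, I, 0) and A = J - R = (A_ij), the
    feedback K replaces E1 by an arbitrary positive semidefinite matrix, and F_S,
    F_H only change A11. Conditions (a) and (b) together say that [A31 A33] has
    full row rank. A pair (E', A') has index at most one iff no nonzero x in
    ker E' satisfies y^* A' x = 0 for all y in the left kernel of E'; this test
    for a closed-loop pair forces [A31 A33] to have full row rank and
    ker E' + {y | y^* A S_4 = 0} to be everything, which gives the upper bound on the
    rank. Conversely F_S = 0 and F_H = I always work: for x in the kernel of the
    compressed pencil, dissipativity gives B^* x = 0 and R x = 0, so x lies in
    ker E, ker B^* and ker A33, and A13 x vanishes as soon as ker E1 contains
    A13 (ker A33). Since A13 is injective on ker A33, this leaves every rank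
    r in the stated range. Existence of the Weierstrass form of such a pair
    reduces to the Jordan form of a square matrix. *)

(** * Jordan form *)

(** The ranks of the powers start at [n] and never increase, so they cannot drop strictly [n.+1]
    times in a row. *)
Lemma rank_exprS_stable (F : fieldType) n (N : 'M[F]_n) :
  exists k, \rank (N ^+ k.+1) == \rank (N ^+ k).
Proof.
case: (boolP [exists k : 'I_n.+1, \rank (N ^+ k.+1) == \rank (N ^+ k)]).
  by case/existsP=> k; exists k.
rewrite negb_exists => /forallP dec.
have bound k : (k <= n.+1)%N -> (\rank (N ^+ k) + k <= n)%N.
  elim: k => [|k IHk] lekn; first by rewrite addn0 rank_leq_row.
  have := dec (Ordinal lekn); rewrite /= => neq.
  have le : (\rank (N ^+ k.+1) <= \rank (N ^+ k))%N.
    by rewrite exprS; apply: mxrankM_maxr.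
  have := IHk (ltnW lekn); lia.
by have := bound n.+1 (leqnn _); lia.
Qed.

(* No nilpotency is assumed: k.+1 is the largest size of a Jordan block of N for
   the eigenvalue 0. *)
Lemma jordan_chain (F : fieldType) n (N : 'M[F]_n) :
  N \notin unitmx ->
  exists k (v : 'rV_n) (f : 'cV_n),
    [/\ v *m N ^+ k.+1 = 0, N ^+ k.+1 *m f = 0 & (v *m N ^+ k *m f) 0 0 != 0].
Proof.
move=> Nnu.
have [k rkk kmin] := ex_minnP (rank_exprS_stable N).
case: k rkk kmin => [|k] rkk kmin.
  by case/negP: Nnu; rewrite -row_free_unit /row_free -[N]expr1 (eqP rkk) expr0 mxrank1.
have kerS j : (kermx (N ^+ j) <= kermx (N ^+ j.+1))%MS.
  by apply/sub_kermxP; rewrite exprSr -mulmxE mulmxA mulmx_ker mul0mx.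
have : ~~ (kermx (N ^+ k.+1) <= kermx (N ^+ k))%MS.
  apply/negP=> le; suff /kmin : \rank (N ^+ k.+1) == \rank (N ^+ k) by rewrite ltnn.
  have := mxrankS le; have := mxrankS (kerS k); rewrite !mxrank_ker.
  have := rank_leq_row (N ^+ k); have := rank_leq_row (N ^+ k.+1); lia.
case/row_subPn=> i; set v := row _ _ => vk.
have vN : v *m N ^+ k.+1 = 0 by rewrite -row_mul mulmx_ker row0.
(* If [v *m N ^+ k] were [u *m N ^+ k.+1], then [u] would be in the left kernel of [N ^+ k.+2],
   which by rank stability is that of [N ^+ k.+1]; this contradicts the choice of [v]. Some column
   of the cokernel therefore serves as [f]. *)
have : ~~ (v *m N ^+ k <= N ^+ k.+1)%MS.
  apply/negP=> /submxP[u eu]; case/negP: vk; apply/sub_kermxP.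
  have : (u <= kermx (N ^+ k.+2))%MS.
    by apply/sub_kermxP; rewrite exprSr -mulmxE mulmxA -eu -mulmxA mulmxE -exprSr.
  have /eqmxP <- : (kermx (N ^+ k.+1) == kermx (N ^+ k.+2))%MS.
    by rewrite -(mxrank_leqif_eq (kerS _)).2 !mxrank_ker (eqP rkk).
  by move/sub_kermxP; rewrite -eu.
rewrite submxE => /matrix0Pn[i0 [j nz]].
exists k, v, (col j (cokermx (N ^+ k.+1))); split=> //.
  by rewrite colE mulmxA mulmx_coker mul0mx.
by rewrite colE mulmxA -colE mxE -(ord1 i0).
Qed.

(* The rows v N^i span an invariant subspace; an invariant complement is the set
   of all w with w N^i f = 0 for every i. *)
Lemma jordan_split (F : numClosedFieldType) n (A : 'M[F]_n) (l : F) :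
  eigenvalue A l ->
  exists k m (U : 'M_(k.+1, n)) (V : 'M_(m, n)) (A' : 'M_m),
  [/\ n = (k.+1 + m)%N, row_free (col_mx U V), V *m A = A' *m V &
    U *m A = jordan_block l k.+1 *m U].
Proof.
move=> eig; pose N := A - l%:M.
have : N \notin unitmx.
  by rewrite -row_free_unit -kermx_eq0 -/(eigenspace A l).
case/jordan_chain=> k [v [f [vN Nf nz]]].
have AE : A = N + l%:M by rewrite subrK.
have vN0 i : (k < i)%N -> v *m N ^+ i = 0.
  by move=> lt; rewrite -(subnKC lt) exprD -mulmxE mulmxA vN mul0mx.
have Nf0 i : (k < i)%N -> N ^+ i *m f = 0.
  by move=> lt; rewrite -(subnK lt) exprD -mulmxE -mulmxA Nf mulmx0.
pose U := \matrix_(i < k.+1) (v *m N ^+ i).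
(* The exponent [k - j] makes [U *m G] upper triangular with constant diagonal [v *m N ^+ k *m f].
   Its invertibility makes the left kernel of [G] a complement of the span of [U]. *)
pose G := \matrix_(i < n, j < k.+1) (N ^+ (k - j) *m f) i 0.
have mulG p (w : 'M_(p, n)) i j : (w *m G) i j = (w *m N ^+ (k - j) *m f) i 0.
  by rewrite -mulmxA !mxE; apply: eq_bigr => x _; rewrite mxE.
have kerG (w : 'rV_n) : w *m G = 0 <-> forall i, w *m N ^+ i *m f = 0.
  split=> [w0 i|w0].
    have [lt|le] := ltnP k i; first by rewrite -mulmxA Nf0 ?mulmx0.
    apply/matrixP=> a b; rewrite !ord1.
    have := mulG _ w 0 (inord (k - i)); rewrite w0 inordK; last by lia.
    by rewrite subKn // !mxE => <-.
  by apply/matrixP=> a b; rewrite mulG w0 !mxE.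
have mulUG i j : (U *m G) i j = (v *m N ^+ (i + (k - j)) *m f) 0 0.
  have -> : (U *m G) i j = row i (U *m N ^+ (k - j) *m f) 0 0 by rewrite mulG !mxE.
  by rewrite !row_mul rowK exprD -mulmxE !mulmxA.
have UGu : U *m G \in unitmx.
  rewrite unitmxE -det_tr det_trig; last first.
    apply/is_trig_mxP=> i j lt; rewrite mxE mulUG vN0 ?mul0mx ?mxE //.
    by have := ltn_ord j; lia.
  rewrite unitfE; apply/prodf_neq0 => i _.
  by rewrite mxE mulUG subnKC // -ltnS.
pose V := row_base (kermx G).
have VG : V *m G = 0 by apply/sub_kermxP; rewrite eq_row_base.
have : (V *m A <= V)%MS.
  rewrite (eqmxMr _ (eq_row_base _)) eq_row_base; apply/row_subP => i; apply/sub_kermxP/kerG => j.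
  have /kerG w0 : row i (kermx G) *m G = 0 by rewrite -row_mul mulmx_ker row0.
  rewrite row_mul AE mulmxDr mulmxDl mulmxDl mul_mx_scalar -!scalemxAl w0.
  by rewrite scaler0 addr0 -[_ *m N *m _]mulmxA -[N *m _]/(N * N ^+ j) -exprS w0.
case/submxP=> A' VA.
exists k, (\rank (kermx G)), U, V, A'; split=> //.
- have rG : \rank G = k.+1.
    apply/eqP; rewrite eqn_leq rank_leq_col /=.
    by rewrite -[X in (X <= _)%N](mxrank_unit UGu) mxrankM_maxr.
  by rewrite mxrank_ker rG subnKC // -rG rank_leq_row.
- apply: inj_row_free => x; rewrite -[x]hsubmxK mul_row_col => x0.
  have a0 : lsubmx x = 0.
    apply/(row_free_inj (A := U *m G)); first by rewrite row_free_unit.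
    rewrite mul0mx /=; move/(congr1 (mulmx^~ G)): x0.
    by rewrite mulmxDl -[_ *m V *m G]mulmxA VG mulmx0 addr0 mul0mx mulmxA.
  have b0 : rsubmx x = 0.
    apply/(row_free_inj (A := V)); first by rewrite row_base_free.
    by rewrite mul0mx -x0 a0 mul0mx add0r.
  by rewrite a0 b0 row_mx0.
- apply/row_matrixP=> i; rewrite !row_mul rowK.
  (* In the last row, [i = k], the out-of-range [inord i.+1] is cancelled by the factor
     [(i < k)%:R], in agreement with [v *m N ^+ k.+1 = 0]. *)
  have -> : row i (jordan_block l k.+1) =
      l *: delta_mx 0 i + (i < k)%:R *: delta_mx 0 (inord i.+1).
    apply/rowP=> j; rewrite !mxE !eqxx /= [j == i]eq_sym.
    have [ik|ik] := ltnP i k; last first.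
      have -> : (i.+1 == j :> nat) = false by have := ltn_ord j; lia.
      by rewrite mul0r addr0; case: eqVneq => _; rewrite ?mulr1 ?mulr0.
    have -> : (j == inord i.+1) = (i.+1 == j).
      by rewrite -(inj_eq val_inj) /= inordK // eq_sym.
    have [<-|_] := eqVneq i j; rewrite mul1r ?mulr1 ?mulr0 ?add0r; last by case: eqP.
    by rewrite eqn_leq ltnn addr0.
  rewrite mulmxDl -!scalemxAl -!rowE rowK AE mulmxDr mul_mx_scalar addrC; congr (_ + _).
  rewrite -mulmxA mulmxE -exprSr rowK; have [ik|ik] := ltnP i k.
    by rewrite scale1r inordK.
  by rewrite scale0r vN0.
Qed.

(** Strong induction on the size: [jordan_split] peels off one block at an eigenvalue. The blocks
    are collected in a list, so that adding one is a cons that [mxdiag_recl] matches. *)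
Lemma jordan_form (F : numClosedFieldType) n (A : 'M[F]_n) :
  exists (s : nat) (p : 'I_s -> nat) (a : 'I_s -> F) (e : (\sum_i p i)%N = n)
    (P : 'M_n),
    P \in unitmx /\
    P *m A = castmx (e, e) (\mxdiag_i jordan_block (a i) (p i)) *m P.
Proof.
suff [b [e [P PA]]] : exists (b : seq (nat * F))
    (e : (\sum_(i < size b) (nth (0%N, 0%R) b i).1)%N = n)
    (P : 'M_n), P \in unitmx /\
    P *m A = castmx (e, e) (\mxdiag_(i < size b)
      jordan_block (nth (0%N, 0%R) b i).2 (nth (0%N, 0%R) b i).1) *m P.
  by exists (size b), (fun i => (nth (0%N, 0%R) b i).1), (fun i => (nth (0%N, 0%R) b i).2), e, P.
elim/ltn_ind: n A => n IH A; case: (posnP n) => [n0|n_gt0].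
  exists [::]; subst n; exists (big_ord0 _ _ _ _), 1%:M; split; first exact: unitmx1.
  by rewrite [LHS]flatmx0 [RHS]flatmx0.
have [l /jordan_split[k [m [U [V [A' [en UVf VA UA]]]]]]] := eigenvalue_closed A n_gt0.
have ltmn : (m < n)%N by rewrite en; lia.
have [b [e [P [Pu PA]]]] := IH m ltmn A'.
move: e PA; set p := fun i : 'I_(size b) => (nth (0%N, 0%R) b i).1 => e.
case: m / e A' V P Pu ltmn en UVf VA => A' V P Pu _ en UVf VA.
rewrite castmx_id => PA.
subst n; clear IH n_gt0.
exists ((k.+1, l) :: b).
pose q := fun i : 'I_(size b).+1 => (nth (0%N, 0%R) ((k.+1, l) :: b) i).1.
exists (esym (mxsize_recl (p_ := q))), (col_mx U (P *m V)); split.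
  have -> : col_mx U (P *m V) = block_mx 1%:M 0 0 P *m col_mx U V.
    by rewrite mul_block_col mul1mx !mul0mx addr0 add0r.
  rewrite unitmx_mul -[X in _ && X]row_free_unit UVf andbT.
  by rewrite unitmxE det_lblock det1 mul1r -unitmxE.
rewrite (mxdiag_recl (p_ := q)) castmx_comp castmx_id.
rewrite mul_col_mx mul_block_col !mul0mx addr0 add0r UA -mulmxA VA.
by rewrite mulmxA PA mulmxA.
Qed.

(** * Pencils of index at most one *)

Lemma mulmx_row_eq0 (F : fieldType) p q (x : 'M[F]_(p, q)) :
  (forall y : 'rV_p, y *m x = 0) -> x = 0.
Proof. by move=> x0; apply/row_matrixP=> i; rewrite rowE x0 row0. Qed.

Lemma mxdiag_jordan_nil_le1 (C : numClosedFieldType) t (q : 'I_t -> nat) :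
  (forall j, q j <= 1)%N -> \mxdiag_j jordan_block (0 : C) (q j) = 0.
Proof.
move=> q1; rewrite -[RHS]mxdiag0; apply: eq_mxdiag => j.
apply/matrixP=> i k; rewrite !mxE; case: eqP => // _.
by have -> : (i.+1 == k :> nat) = false by have := ltn_ord k; have := q1 j; lia.
Qed.

(** With index at most one the nilpotent part is zero. In Weierstrass coordinates [E *m x = 0] then
    kills the upper part of [x], and the tests with rows [row_mx 0 y2] kill the lower part. *)
Lemma regular_index_le1_ker (C : numClosedFieldType) n (E A : 'M[C]_n) :
  regular_index_le1 E A ->
  forall x : 'cV_n, E *m x = 0 ->
    (forall y : 'rV_n, y *m E = 0 -> y *m A *m x = 0) -> x = 0.
Proof.
case=> _ [k [s [t [p [a [q [[eN [P [Q [Pu Qu PEQ PAQ]]]] ->]]]]]] q1] x Ex yAx.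
rewrite mxdiag_jordan_nil_le1 in PEQ; last first.
  by move=> j; apply: leq_trans q1; apply: (leq_bigmax j).
move: PAQ; set S := \mxdiag_i _ => PAQ.
case: n / eN E A P Q Pu Qu PEQ x Ex yAx S PAQ => E A P Q Pu Qu PEQ x Ex yAx S PAQ.
rewrite !castmx_id in PEQ PAQ.
have xQ : x = Q *m (invmx Q *m x) by rewrite mulKVmx.
move: xQ; set x' := invmx Q *m x => xQ.
have u0 : usubmx x' = 0.
  have := congr1 (mulmx^~ x') PEQ; rewrite -!mulmxA -xQ Ex mulmx0.
  rewrite -[x']vsubmxK mul_block_col mul1mx !mul0mx !addr0 col_mxKu.
  by move/(congr1 usubmx); rewrite linear0 col_mxKu.
have d0 : dsubmx x' = 0.
  apply: mulmx_row_eq0 => y2.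
  have yE : row_mx 0 y2 *m P *m E = 0.
    apply: (row_free_inj (A := Q)); first by rewrite row_free_unit.
    by rewrite mul0mx /= -!mulmxA (mulmxA P) PEQ mul_row_block !mul0mx !mulmx0 !addr0 row_mx0.
  have := yAx _ yE.
  have -> : row_mx 0 y2 *m P *m A *m x = row_mx 0 y2 *m (P *m A *m Q *m x').
    by rewrite xQ !mulmxA.
  rewrite PAQ.
  rewrite -[x']vsubmxK mul_block_col mul1mx !mul0mx addr0 add0r mul_row_col.
  by rewrite mul0mx add0r col_mxKd.
by rewrite xQ -[x']vsubmxK u0 d0 col_mx0 mulmx0.
Qed.

(** Once [E] is in rank normal form, the kernel test makes the lower right block [D] of the
    transformed [A] injective, hence invertible. Elimination with pivot [D] decouples the pencil and
    leaves a Schur complement as the finite part. *)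
Lemma index1_block_form (F : fieldType) n (E A : 'M[F]_n) :
  (forall x : 'cV_n, E *m x = 0 ->
    (forall y : 'rV_n, y *m E = 0 -> y *m A *m x = 0) -> x = 0) ->
  exists r s (e : (r + s)%N = n) (P Q : 'M_n) (S : 'M_r),
    [/\ P \in unitmx, Q \in unitmx,
        P *m E *m Q = castmx (e, e) (block_mx 1%:M 0 0 0)
      & P *m A *m Q = castmx (e, e) (block_mx S 0 0 1%:M)].
Proof.
move=> inj.
have [r [s [e [L [U [Lu Uu EE]]]]]] : exists r s (e : (r + s)%N = n) (L U : 'M_n),
    [/\ L \in unitmx, U \in unitmx &
        L *m E *m U = castmx (e, e) (block_mx 1%:M 0 0 0)].
  have e : (\rank E + (n - \rank E))%N = n by rewrite subnKC ?rank_leq_row.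
  exists (\rank E), (n - \rank E)%N, e, (invmx (col_ebase E)), (invmx (row_ebase E)).
  rewrite !unitmx_inv col_ebase_unit row_ebase_unit; split=> //.
  rewrite -[X in _ *m X *m _]mulmx_ebase !mulmxA mulVmx ?col_ebase_unit // mul1mx mulmxK ?row_ebase_unit //.
  by move: (\rank E) (n - \rank E)%N e => r s e; case: n / e {E A inj}; rewrite castmx_id pid_mx_block.
case: n / e E A inj L U Lu Uu EE => E A inj L U Lu Uu EE; rewrite castmx_id in EE.
pose M := L *m A *m U.
set S := ursubmx M; set T := dlsubmx M; set D := drsubmx M.
have ME : M = block_mx (ulsubmx M) S T D by rewrite submxK.
have Du : D \in unitmx.
  rewrite -unitmx_tr -row_free_unit; apply: inj_row_free => v vD.
  have Dv : D *m v^T = 0 by rewrite -[D]trmxK -trmx_mul vD trmx0.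
  have : U *m col_mx 0 v^T = 0.
    apply: inj => [|y yE].
      apply: (can_inj (mulKmx Lu)).
      by rewrite mulmx0 !mulmxA EE mul_block_col mul1mx !mul0mx !addr0 col_mx0.
    pose z := y *m invmx L.
    have yz : y = z *m L by rewrite mulmxKV.
    have z0 : lsubmx z = 0.
      have : z *m (L *m E *m U) = 0 by rewrite !mulmxA -yz yE mul0mx.
      rewrite EE -{1}[z]hsubmxK mul_row_block mulmx1 !mulmx0 !addr0.
      by move/(congr1 lsubmx); rewrite row_mxKl linear0.
    have -> : y *m A *m (U *m col_mx 0 v^T) = z *m (M *m col_mx 0 v^T).
      by rewrite yz /M !mulmxA.
    rewrite ME -[z]hsubmxK z0 mul_block_col Dv !mulmx0 !add0r.
    by rewrite mul_row_col mul0mx mulmx0 addr0.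
  move/(congr1 (mulmx (invmx U))); rewrite mulKmx // mulmx0.
  move/(congr1 dsubmx); rewrite col_mxKd linear0 => /(congr1 trmx).
  by rewrite trmxK trmx0.
exists r, s, erefl, (block_mx 1%:M (- S *m invmx D) 0 (invmx D) *m L),
  (U *m block_mx 1%:M 0 (- invmx D *m T) 1%:M), (ulsubmx M - S *m invmx D *m T).
rewrite !castmx_id; split.
- by rewrite unitmx_mul Lu andbT unitmxE det_ublock det1 mul1r -unitmxE unitmx_inv.
- by rewrite unitmx_mul Uu unitmxE det_lblock !det1 mul1r unitr1.
- rewrite -!mulmxA (mulmxA E) (mulmxA L) (mulmxA L) EE !mulmx_block.
  by rewrite !(mulmx0, mul0mx, mulmx1, mul1mx, addr0, add0r).
- rewrite -!mulmxA (mulmxA A) (mulmxA L) (mulmxA L) -/M {1}ME !mulmx_block.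
  rewrite !(mulmx0, mul0mx, mulmx1, mul1mx, addr0, add0r).
  rewrite !mulNmx !mulmxN !mulmxA mulmxV // mul1mx subrr !mulmx0 subr0.
  by rewrite -[S *m invmx D *m D]mulmxA !mulVmx // mulmx1 subrr.
Qed.

Lemma regular_index_le1P (C : numClosedFieldType) n (E A : 'M[C]_n) :
  regular_index_le1 E A <->
  forall x : 'cV_n, E *m x = 0 ->
    (forall y : 'rV_n, y *m E = 0 -> y *m A *m x = 0) -> x = 0.
Proof.
split=> [|inj]; first exact: regular_index_le1_ker.
have [r [s [e [P [Q [S [Pu Qu PEQ PAQ]]]]]]] := index1_block_form inj.
split.
  (* Up to a nonzero factor the determinant of the pencil at [l] is [char_poly S] at [l]. *)
  have /closed_nonrootP[l nl] : char_poly S != 0.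
    by rewrite monic_neq0 // char_poly_monic.
  exists l; rewrite -unitfE -unitmxE.
  have : P *m (l *: E - A) *m Q \in unitmx; last by rewrite !unitmx_mul Pu Qu andbT.
  rewrite mulmxBr mulmxBl -scalemxAr -scalemxAl PEQ PAQ.
  case: n / e {inj E A P Q Pu Qu PEQ PAQ}.
  rewrite !castmx_id scale_block_mx opp_block_mx add_block_mx !scaler0 !subr0 sub0r.
  have N1 : (- 1%:M : 'M[C]_s) \in unitmx.
    by rewrite -scaleN1r unitmxZ ?unitrN1 // unitmx1.
  rewrite unitmxE det_ublock unitrM -!unitmxE N1 andbT scalemx1.
  rewrite -eigenvalue_root_char /eigenvalue negbK kermx_eq0 row_free_unit in nl.
  by rewrite -opprB -scaleN1r unitmxZ ?unitrN1.
(* At infinity there are [s] Jordan blocks of size one, so the nilpotent part vanishes. *)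
have [t [q [q1 es]]] : exists t (q : 'I_t -> nat),
    (forall j, q j <= 1)%N /\ (\sum_j q j)%N = s.
  by exists s, (fun=> 1%N); split=> //; rewrite sum1_card card_ord.
have [u [p [a [er [T [Tu TS]]]]]] := jordan_form S.
exists (\max_j q j)%N; last by apply/bigmax_leqP => j _.
exists u, t, p, a, q; split=> //.
case: s / es e PEQ PAQ => e; case: r / er e S T Tu TS => e S T Tu; rewrite castmx_id => TS PEQ PAQ.
exists e, (castmx (e, e) (block_mx T 0 0 1%:M) *m P),
  (Q *m castmx (e, e) (block_mx (invmx T) 0 0 1%:M)).
rewrite mxdiag_jordan_nil_le1 //.
case: n / e E A inj P Q Pu Qu PEQ PAQ => E A inj P Q Pu Qu PEQ PAQ.
rewrite !castmx_id in PEQ PAQ *; split.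
- by rewrite unitmx_mul Pu andbT unitmxE det_ublock det1 mulr1 -unitmxE.
- by rewrite unitmx_mul Qu unitmxE det_ublock det1 mulr1 -unitmxE unitmx_inv.
- rewrite -!mulmxA (mulmxA E) (mulmxA P) (mulmxA P) PEQ !mulmx_block.
  by rewrite !(mulmx0, mul0mx, mulmx1, mul1mx, addr0, add0r) mulmxV.
- rewrite -!mulmxA (mulmxA A) (mulmxA P) (mulmxA P) PAQ !mulmx_block.
  by rewrite !(mulmx0, mul0mx, mulmx1, mul1mx, addr0, add0r) mulmxA TS mulmxK.
Qed.

(** * Null space bases and positive semidefinite matrices *)

Lemma ctmxM (C : numClosedFieldType) p q r (M : 'M[C]_(p, q)) (N : 'M_(q, r)) :
  (M *m N)^t* = N^t* *m M^t*.
Proof. by rewrite trmx_mul map_mxM. Qed.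

Lemma ctmxD (C : numClosedFieldType) p q (M N : 'M[C]_(p, q)) :
  (M + N)^t* = M^t* + N^t*.
Proof. by rewrite linearD map_mxD. Qed.

Lemma ctmxN (C : numClosedFieldType) p q (M : 'M[C]_(p, q)) : (- M)^t* = - M^t*.
Proof. by rewrite linearN map_mxN. Qed.

Lemma ctmxZ (C : numClosedFieldType) p q a (M : 'M[C]_(p, q)) :
  (a *: M)^t* = a^* *: M^t*.
Proof. by rewrite linearZ map_mxZ. Qed.

Lemma ctmx0 (C : numClosedFieldType) p q : (0 : 'M[C]_(p, q))^t* = 0.
Proof. by rewrite trmx0 map_mx0. Qed.

Lemma ctmx1 (C : numClosedFieldType) p : (1%:M : 'M[C]_p)^t* = 1%:M.
Proof. by rewrite trmx1 map_mx1. Qed.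

Lemma mxrank_ct (C : numClosedFieldType) p q (M : 'M[C]_(p, q)) :
  \rank (M^t*) = \rank M.
Proof. by rewrite mxrank_map mxrank_tr. Qed.

Lemma mulmx_col_eq0 (F : fieldType) p q r (M : 'M[F]_(p, q)) (N : 'M_(q, r)) :
  (forall v : 'cV_r, M *m (N *m v) = 0) -> M *m N = 0.
Proof.
move=> MN0; apply: trmx_inj; rewrite trmx0.
by apply: mulmx_row_eq0 => y; rewrite -[y]trmxK -trmx_mul -mulmxA MN0 trmx0.
Qed.

Lemma ker_factor (F : fieldType) p q n (G : 'M[F]_(p, n)) (H : 'M[F]_(q, n)) :
  (forall v : 'cV_n, G *m v = 0 -> H *m v = 0) -> exists D, H = D *m G.
Proof.
move=> GH; apply/submxP; rewrite submxE; apply/eqP; apply: mulmx_col_eq0 => v.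
by apply: GH; rewrite mulmxA mulmx_coker mul0mx.
Qed.

Lemma mxrank_ker_le (F : fieldType) p q n (G : 'M[F]_(p, n)) (H : 'M[F]_(q, n)) :
  (forall v : 'cV_n, G *m v = 0 -> H *m v = 0) -> (\rank H <= \rank G)%N.
Proof. by case/ker_factor=> D ->; apply: mxrankM_maxr. Qed.

Lemma col_free_eq0 (F : fieldType) p q r (S : 'M[F]_(p, q)) (X : 'M_(q, r)) :
  \rank S = q -> S *m X = 0 -> X = 0.
Proof.
move=> rS SX; apply: trmx_inj; apply: (row_free_inj (A := S^T)).
  by rewrite /row_free mxrank_tr rS.
by rewrite /= -trmx_mul SX trmx0 trmx0 mul0mx.
Qed.

Lemma left_null_mul (C : numClosedFieldType) p q k (M : 'M[C]_(p, q)) (T : 'M_(p, k)) :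
  left_null_basis M T -> T^t* *m M = 0.
Proof.
case=> _ TM; apply: mulmx_row_eq0 => y.
have /TM : exists z, T *m y^t* = T *m z by exists (y^t*).
by rewrite ctmxM trmxCK mulmxA.
Qed.

Lemma left_null_sub (C : numClosedFieldType) p q k (M : 'M[C]_(p, q)) (T : 'M_(p, k))
    r (Y : 'M_(r, p)) :
  left_null_basis M T -> Y *m M = 0 -> (Y <= T^t*)%MS.
Proof.
case=> _ TM YM; apply/row_subP => i.
have /TM[z Yz] : ((row i Y)^t*)^t* *m M = 0 by rewrite trmxCK -row_mul YM row0.
by apply/submxP; exists (z^t*); rewrite -ctmxM -Yz trmxCK.
Qed.

Lemma left_null_eqmx (C : numClosedFieldType) p q k (M : 'M[C]_(p, q)) (T : 'M_(p, k)) :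
  left_null_basis M T -> (T^t* :=: kermx M)%MS.
Proof.
move=> TM; apply/eqmxP/andP; split; last by apply: (left_null_sub TM); apply: mulmx_ker.
by apply/sub_kermxP/left_null_mul.
Qed.

Lemma left_null_rank (C : numClosedFieldType) p q k (M : 'M[C]_(p, q)) (T : 'M_(p, k)) :
  left_null_basis M T -> k = (p - \rank M)%N.
Proof. by move=> TM; rewrite -mxrank_ker -(left_null_eqmx TM) mxrank_ct; case: TM. Qed.

(** Double annihilator argument: the transposed columns of [cokermx M^T] kill [M], so they are
    combinations of the rows of [T^t*] and kill [Y] as well. *)
Lemma left_null_range (C : numClosedFieldType) p q k (M : 'M[C]_(p, q)) (T : 'M_(p, k))
    r (Y : 'M_(p, r)) :
  left_null_basis M T -> T^t* *m Y = 0 -> exists X, Y = M *m X.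
Proof.
move=> TM TY; suff /submxP[X eX] : (Y^T <= M^T)%MS.
  by exists (X^T); rewrite -[Y]trmxK eX trmx_mul trmxK.
rewrite submxE -[cokermx _]trmxK -trmx_mul; apply/eqP.
have : ((cokermx M^T)^T <= T^t*)%MS.
  by apply: (left_null_sub TM); apply: trmx_inj; rewrite trmx_mul trmxK mulmx_coker trmx0.
by case/submxP=> D ->; rewrite -mulmxA TY mulmx0 trmx0.
Qed.

Lemma right_null_mul (C : numClosedFieldType) p q k (M : 'M[C]_(p, q)) (S : 'M_(q, k)) :
  right_null_basis M S -> M *m S = 0.
Proof.
case=> _ MS; rewrite -[S]mulmx1; apply: mulmx_col_eq0 => v.
by apply/MS; exists (1%:M *m v); rewrite mulmxA.
Qed.

Lemma right_null_range (C : numClosedFieldType) p q k (M : 'M[C]_(p, q)) (S : 'M_(q, k))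
    r (Y : 'M_(q, r)) :
  right_null_basis M S -> M *m Y = 0 -> exists X, Y = S *m X.
Proof.
case=> _ MS MY; suff /submxP[X eX] : (Y^T <= S^T)%MS.
  by exists (X^T); rewrite -[Y]trmxK eX trmx_mul trmxK.
apply/row_subP => i; rewrite -tr_col.
have /MS[z ->] : M *m col i Y = 0 by rewrite colE mulmxA MY mul0mx.
by rewrite trmx_mul submxMl.
Qed.

Lemma left_null_basis_exists (C : numClosedFieldType) p q (M : 'M[C]_(p, q)) :
  exists k (T : 'M_(p, k)), left_null_basis M T.
Proof.
exists (\rank (kermx M)), ((row_base (kermx M))^t*); split.
  by rewrite mxrank_ct; apply/eqP; apply: row_base_free.
move=> x; split=> [xM|[y ->]]; last first.
  have rM : row_base (kermx M) *m M = 0 by apply/sub_kermxP; rewrite eq_row_base.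
  by rewrite ctmxM trmxCK -mulmxA rM mulmx0.
have /submxP[D xD] : (x^t* <= row_base (kermx M))%MS by rewrite eq_row_base; apply/sub_kermxP.
by exists (D^t*); rewrite -ctmxM -xD trmxCK.
Qed.

Lemma ctmx_self_ge0 (C : numClosedFieldType) n (x : 'cV[C]_n) : 0 <= (x^t* *m x) 0 0.
Proof. by rewrite mxE sumr_ge0 // => i _; rewrite !mxE mulrC mul_conjC_ge0. Qed.

Lemma ctmx_self_eq0 (C : numClosedFieldType) n (x : 'cV[C]_n) :
  (x^t* *m x) 0 0 = 0 -> x = 0.
Proof.
rewrite mxE => /eqP; rewrite psumr_eq0 => [/allP x0|i _]; last first.
  by rewrite !mxE mulrC mul_conjC_ge0.
apply/colP=> i; have := x0 i (mem_index_enum _).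
by rewrite !mxE mulrC mul_conjC_eq0 => /eqP.
Qed.

(** Moving from an isotropic [x] in the direction of [- (M *m x)] would make the form negative
    unless [M *m x] vanishes. *)
Lemma psdmx_ker (C : numClosedFieldType) n (M : 'M[C]_n) (x : 'cV_n) :
  psdmx M -> (x^t* *m M *m x) 0 0 = 0 -> M *m x = 0.
Proof.
case=> herm pos x0; apply: ctmx_self_eq0.
set y := M *m x; set b := (_ *m _) 0 0.
have b0 : 0 <= b by apply: ctmx_self_ge0.
pose a := (y^t* *m M *m y) 0 0; have a0 : 0 <= a := pos y.
have bC : b^* = b by apply: geC0_conj.
have aC : (a + 1)^* = a + 1 by rewrite geC0_conj // addr_ge0.
(* the form at [(a + 1) x - b y] is [- b^2 (a + 2)] *)
have := pos ((a + 1) *: x - b *: y).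
rewrite ctmxD ctmxN !ctmxZ bC aC.
have xM : x^t* *m M = y^t* by rewrite ctmxM herm.
rewrite !(mulmxDl, mulNmx, mulmxDr, mulmxN, =^~ scalemxAl, =^~ scalemxAr).
have yx : (y^t* *m M *m x) 0 0 = b by rewrite -mulmxA.
have xy : (x^t* *m M *m y) 0 0 = b by rewrite xM.
have ea : (y^t* *m M *m y) 0 0 = a by [].
move: x0 yx xy ea; move: (_ *m x) (_ *m x) (_ *m y) (_ *m y) => X Y Z W x0 yx xy ea.
rewrite !mxE x0 yx xy ea.
have -> : (a + 1) * ((a + 1) * 0 - b * b) + ((a + 1) * - (b * b) - - (b * (b * a)))
  = - (b ^+ 2 * (a + 2)) by ring.
rewrite oppr_ge0 => le0; apply/eqP; rewrite -sqrf_eq0.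
have a2 : 0 < a + 2 by rewrite ltr_wpDl.
by rewrite eq_le exprn_ge0 // andbT -(pmulr_lle0 _ a2).
Qed.

Lemma psdmx_add_gram (C : numClosedFieldType) n p (Q : 'M[C]_n) (L : 'M_(p, n)) :
  psdmx Q -> psdmx (Q + L^t* *m L).
Proof.
case=> QC Q0; split=> [|x]; first by rewrite ctmxD ctmxM trmxCK QC.
rewrite mulmxDr mulmxDl mxE addr_ge0 //.
by rewrite mulmxA -ctmxM -mulmxA ctmx_self_ge0.
Qed.

Lemma psdmx_add_gram_ker (C : numClosedFieldType) n p (R : 'M[C]_n) (L : 'M_(p, n))
    (x : 'cV_n) :
  psdmx R -> (R + L^t* *m L) *m x = 0 -> L *m x = 0.
Proof.
case=> _ R0 /(congr1 (mulmx (x^t*))); rewrite mulmx0 mulmxDl mulmxDr => e0.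
apply: ctmx_self_eq0; apply/eqP.
have : (x^t* *m R *m x) 0 0 + ((L *m x)^t* *m (L *m x)) 0 0 == 0.
  have /matrixP/(_ 0 0) := e0.
  by rewrite [LHS]mxE [RHS]mxE ctmxM !mulmxA => ->.
by rewrite paddr_eq0 ?R0 ?ctmx_self_ge0 // => /andP[].
Qed.

(** The [J] term is imaginary and the [R] term real, so both vanish, and semidefiniteness gives
    [R *m x = 0]. On such [x] only the skew part acts, which lets tests from the left and from the
    right be exchanged. *)
Lemma dissipative_ker (C : numClosedFieldType) n (J R : 'M[C]_n) (x : 'cV_n) :
  J = - J^t* -> psdmx R -> x^t* *m (J - R) *m x = 0 ->
  R *m x = 0 /\ x^t* *m (J - R) = - ((J - R) *m x)^t*.
Proof.
move=> hJ hR x0; have [RC _] := hR.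
have eJR : x^t* *m J *m x = x^t* *m R *m x.
  by apply/eqP; rewrite -subr_eq0 -mulmxBl -mulmxBr x0.
have eRJ : x^t* *m R *m x = - (x^t* *m J *m x).
  have /(congr1 (fun M => M^t*)) := eJR.
  by rewrite !ctmxM trmxCK RC !mulmxA => <-; rewrite {2}hJ mulmxN mulNmx opprK.
have R0 : R *m x = 0.
  apply: psdmx_ker => //.
  have : x^t* *m R *m x + x^t* *m R *m x = 0 by rewrite {2}eRJ eJR subrr.
  move/matrixP/(_ 0 0); rewrite [LHS]mxE [RHS]mxE -mulr2n => /eqP.
  by rewrite mulrn_eq0 => /eqP.
split=> //; rewrite mulmxBr mulmxBl R0 subr0 ctmxM {1}hJ mulmxN.
by have -> : x^t* *m R = 0; [rewrite -RC -ctmxM R0 ctmx0 | rewrite subr0].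
Qed.

(** * Closed-loop pairs *)

(* In a basis where B = [I; 0] and E = diag(E1, I, 0), this says that the block
   row [A31 A33] of A has full row rank. *)
Definition row_block_full (C : numClosedFieldType) n m (E A : 'M[C]_n) (B : 'M[C]_(n, m)) :=
  forall x : 'cV_n, E *m x = 0 -> B^t* *m x = 0 ->
    (forall (w : 'cV_n) (u : 'cV_m), E *m w = B *m u -> x^t* *m A *m w = 0) -> x = 0.

(** Since [E *m x = 0], the choice [w = x], [u = 0] is allowed; it brings [x] under
    [dissipative_ker], which moves [x] to the other side of [J - R]. *)
Lemma row_block_full_dissipative (C : numClosedFieldType) n m (E J R : 'M[C]_n) (B : 'M[C]_(n, m))
    (x : 'cV_n) :
  J = - J^t* -> psdmx R -> row_block_full E (J - R) B ->
  E *m x = 0 -> B^t* *m x = 0 ->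
  (forall (w : 'cV_n) (u : 'cV_m), E *m w = B *m u -> w^t* *m (J - R) *m x = 0) -> x = 0.
Proof.
move=> hJ hR full Ex Bx wA; apply: full => // w u Ew.
have [_ ->] := dissipative_ker hJ hR (wA x 0 (etrans Ex (esym (mulmx0 _ _)))).
by rewrite mulNmx -[w]trmxCK -ctmxM mulmxA (wA _ _ Ew) ctmx0 oppr0.
Qed.

(** The vectors [w] with [E *m w] in the range of [B] form the kernel of [T1^t* *m E]. The second
    rank equation says that this kernel and the columns of [S3] together span everything. For [x] in
    the range of [T2], [x^t* *m A] vanishes on [S3]; if it also vanishes on that kernel it is zero,
    and the first rank equation gives [x = 0]. *)
Lemma row_block_fullP (C : numClosedFieldType) n m (E A : 'M[C]_n) (B : 'M[C]_(n, m))
    k1 k2 k3 (T1 : 'M_(n, k1)) (T2 : 'M_(n, k2)) (S3 : 'M_(n, k3)) :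
  E^t* = E -> left_null_basis B T1 -> left_null_basis (row_mx E B) T2 ->
  right_null_basis (T2^t* *m A) S3 ->
  row_block_full E A B <->
    \rank (row_mx (row_mx E A) B) = n /\
    (\rank (T1^t* *m E *m S3) + \rank B)%N = \rank (row_mx E B).
Proof.
move=> hE hT1 hT2 hS3.
(* Rank-nullity on the column space of [row_mx E B]: the part killed by [T1^t*] is the column space
   of [B]. *)
have rT1E : (\rank (T1^t* *m E) + \rank B)%N = \rank (row_mx E B).
  have := mxrank_mul_ker ((row_mx E B)^T) ((T1^t*)^T).
  rewrite -trmx_mul !mxrank_tr mul_mx_row (left_null_mul hT1) rank_row_mx0 => <-.
  congr (_ + _)%N; rewrite -mxrank_tr; apply: eqmx_rank; apply/andP; split.
    rewrite sub_capmx tr_row_mx -addsmxE addsmxSr; apply/sub_kermxP.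
    by rewrite -trmx_mul (left_null_mul hT1) trmx0.
  apply: submx_trans (capmxSr _ _) _.
  set K := kermx _; have : T1^t* *m K^T = 0.
    by apply: trmx_inj; rewrite trmx_mul trmxK trmx0 mulmx_ker.
  by case/(left_null_range hT1) => X /(congr1 trmx); rewrite trmxK trmx_mul => ->; apply: submxMl.
have inN (x : 'cV_n) : E *m x = 0 /\ B^t* *m x = 0 <-> exists z, x = T2 *m z.
  have e1 : x^t* *m E = (E *m x)^t* by rewrite ctmxM hE.
  have e2 : x^t* *m B = (B^t* *m x)^t* by rewrite ctmxM trmxCK.
  rewrite -hT2.2 mul_mx_row e1 e2; split=> [[-> ->]|].
    by rewrite !ctmx0 row_mx0.
  rewrite -[0]row_mx0 => /eq_row_mx[/(congr1 (fun M => M^t*)) Ex /(congr1 (fun M => M^t*)) Bx].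
  by rewrite !trmxCK !ctmx0 in Ex Bx.
have T1Ew w : T1^t* *m E *m w = 0 -> exists u : 'cV_m, E *m w = B *m u.
  by rewrite -mulmxA => /(left_null_range hT1).
have T1Eu w (u : 'cV_m) : E *m w = B *m u -> T1^t* *m E *m w = 0.
  by rewrite -mulmxA => ->; rewrite mulmxA (left_null_mul hT1) mul0mx.
split=> [full|[rA rS]].
  split.
    apply/eqP; apply: inj_row_free => y; rewrite !mul_mx_row -[0]row_mx0.
    move=> /eq_row_mx[]; rewrite -[0]row_mx0 => /eq_row_mx[yE yA] yB.
    rewrite -[y]trmxCK (full (y^t*)) ?ctmx0 //.
    - by rewrite -[E]hE -ctmxM yE ctmx0.
    - by rewrite -ctmxM yB ctmx0.
    - by move=> w u _; rewrite trmxCK yA mul0mx.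
  rewrite -rT1E; congr (_ + _)%N; apply/eqP; rewrite eqn_leq mxrankM_maxl /=.
  pose K := (kermx (T1^t* *m E)^T)^T.
  have EK : T1^t* *m E *m K = 0.
    by apply: trmx_inj; rewrite trmx_mul trmxK mulmx_ker trmx0.
  have /row_freeP[Z KZ] : row_free (T2^t* *m A *m K).
    apply: inj_row_free => y yK.
    have /inN[Ex Bx] : exists z, T2 *m y^t* = T2 *m z by exists (y^t*).
    have : T2 *m y^t* = 0.
      apply: full => // w u /T1Eu Ew.
      have : (w^T <= kermx (T1^t* *m E)^T)%MS.
        by apply/sub_kermxP; rewrite -trmx_mul Ew trmx0.
      case/submxP=> v /(congr1 trmx); rewrite trmxK trmx_mul => ->.
      rewrite -/K ctmxM trmxCK; transitivity (y *m (T2^t* *m A *m K) *m v^T).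
        by rewrite !mulmxA.
      by rewrite yK mul0mx.
    by move/(col_free_eq0 hT2.1)/(congr1 (fun M => M^t*)); rewrite trmxCK ctmx0.
  (* The factor on the right projects onto the range of [S3] and changes vectors only within the
     kernel of [T1^t* *m E], so [T1^t* *m E] factors through [S3]. *)
  have : T2^t* *m A *m (1%:M - K *m Z *m (T2^t* *m A)) = 0.
    by rewrite mulmxBr mulmx1 !mulmxA KZ mul1mx subrr.
  case/(right_null_range hS3)=> X eX.
  have eT : T1^t* *m E = T1^t* *m E *m S3 *m X.
    by rewrite -[RHS]mulmxA -eX mulmxBr mulmx1 -(mulmxA K) (mulmxA _ K) EK mul0mx subr0.
  by rewrite {1}eT mxrankM_maxl.
move=> x Ex Bx xA.
have /inN[z xz] := conj Ex Bx.
have {}rS : \rank (T1^t* *m E *m S3) = \rank (T1^t* *m E).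
  by apply/eqP; rewrite -(eqn_add2r (\rank B)) rS rT1E.
have [X eX] : exists X, T1^t* *m E = T1^t* *m E *m S3 *m X.
  suff /submxP[X /(congr1 trmx)] : ((T1^t* *m E)^T <= (T1^t* *m E *m S3)^T)%MS.
    by rewrite trmxK trmx_mul trmxK => eX; exists (X^T).
  rewrite -(mxrank_leqif_sup _).2 ?mxrank_tr ?rS //.
  by rewrite trmx_mul submxMl.
have xA0 : x^t* *m A = 0.
  rewrite -[LHS]mulmx1; apply: mulmx_col_eq0 => v; rewrite mul1mx.
  have /T1Ew[u Ew] : T1^t* *m E *m (v - S3 *m (X *m v)) = 0.
    by rewrite mulmxBr !mulmxA -eX subrr.
  have := xA _ _ Ew; rewrite mulmxBr {2}xz ctmxM !mulmxA.
  by rewrite -(mulmxA (z^t*)) -(mulmxA (z^t*)) (right_null_mul hS3) mulmx0 !mul0mx subr0.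
have fA : row_free (row_mx (row_mx E A) B) by apply/eqP.
rewrite -[x]trmxCK; suff -> : x^t* = 0 by rewrite ctmx0.
apply: (row_free_inj fA); rewrite /= mul0mx !mul_mx_row xA0.
have -> : x^t* *m E = 0 by rewrite -hE -ctmxM Ex ctmx0.
by rewrite -[B]trmxCK -ctmxM Bx ctmx0 !row_mx0.
Qed.

(** * Necessary conditions on a feedback *)

Lemma feedback_mul (C : numClosedFieldType) n m (J R : 'M[C]_n) (B : 'M[C]_(n, m))
    (FS FH : 'M[C]_m) p (x : 'M[C]_(n, p)) :
  B^t* *m x = 0 ->
  (J + B *m FS *m B^t* - (R + B *m FH *m B^t*)) *m x = (J - R) *m x.
Proof.
by move=> Bx; rewrite !(mulmxBl, mulmxDl) -!(mulmxA _ (B^t*)) Bx !mulmx0 !addr0.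
Qed.

(** The vector [x] stays in the kernel of the completed [E], and the feedback in [A] does not see
    it. A left null vector [y] of the completed [E] gives an allowed [w = y^t*], so dissipativity
    turns the hypothesis on [x] into the index test. *)
Lemma row_block_full_necessary (C : numClosedFieldType) n m (E J R : 'M[C]_n)
    (B : 'M[C]_(n, m)) (K FS FH : 'M[C]_m) :
  J = - J^t* -> psdmx R -> psdmx (E + B *m K *m B^t*) ->
  regular_index_le1 (E + B *m K *m B^t*)
    (J + B *m FS *m B^t* - (R + B *m FH *m B^t*)) ->
  row_block_full E (J - R) B.
Proof.
move=> hJ hR [herm _] /regular_index_le1P ind x Ex Bx xA.
apply: ind => [|y yE]; first by rewrite mulmxDl Ex -mulmxA Bx mulmx0 addr0.
rewrite -mulmxA feedback_mul //.
have [_ xA'] := dissipative_ker hJ hR (xA x 0 (etrans Ex (esym (mulmx0 _ _)))).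
suff : x^t* *m (J - R) *m y^t* = 0.
  rewrite xA' mulNmx => /eqP; rewrite oppr_eq0 => /eqP/(congr1 (fun M => M^t*)).
  by rewrite !ctmxM !trmxCK ctmx0.
apply: (xA _ (- (K *m B^t* *m y^t*))).
have : (E + B *m K *m B^t*) *m y^t* = 0 by rewrite -herm -ctmxM yE ctmx0.
by rewrite mulmxDl mulmxN !mulmxA => /eqP; rewrite addr_eq0 => /eqP.
Qed.

(** Feedback is an invertible column operation on [row_mx E B], and rank is subadditive. *)
Lemma feedback_rank_ge (F : fieldType) n m (E : 'M[F]_n) (B : 'M[F]_(n, m)) (X : 'M_(m, n)) :
  (\rank (row_mx E B) <= \rank (E + B *m X)%R + \rank B)%N.
Proof.
have -> : row_mx E B = row_mx (E + B *m X) B *m block_mx 1%:M 0 (- X) 1%:M.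
  by rewrite mul_row_block !mulmx1 mulmx0 add0r mulmxN addrK.
apply: leq_trans (mxrankM_maxl _ _) _.
rewrite -mxrank_tr tr_row_mx -addsmxE -(mxrank_tr (E + _)) -(mxrank_tr B).
exact: mxrank_adds_leqif.
Qed.

(** Let [Et] be the completed [E]. If [T5^t*] kills [Et *m v], then [Et *m v = (J - R) *m S4 *m z];
    as [S4 *m z] is in the kernel of [Et], the index test makes it zero. So multiplying [Et] by
    [T5^t*] loses no rank. *)
Lemma feedback_rank_le (C : numClosedFieldType) n m (E J R : 'M[C]_n)
    (B : 'M[C]_(n, m)) (K FS FH : 'M[C]_m) k4 k5 (S4 : 'M_(n, k4)) (T5 : 'M_(n, k5)) :
  right_null_basis (col_mx E (B^t*)) S4 -> left_null_basis ((J - R) *m S4) T5 ->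
  regular_index_le1 (E + B *m K *m B^t*)
    (J + B *m FS *m B^t* - (R + B *m FH *m B^t*)) ->
  (\rank (E + B *m K *m B^t*)%R <= \rank (T5^t* *m row_mx E B))%N.
Proof.
move=> hS4 hT5 /regular_index_le1P ind.
have /eqP := right_null_mul hS4; rewrite mul_col_mx col_mx_eq0 => /andP[/eqP ES /eqP BS].
set Et := E + _.
have EtE : Et = row_mx E B *m col_mx 1%:M (K *m B^t*).
  by rewrite mul_row_col mulmx1 mulmxA.
apply: (@leq_trans (\rank (T5^t* *m Et))); last first.
  by rewrite EtE mulmxA mxrankM_maxl.
apply: mxrank_ker_le => v; rewrite -mulmxA => /(left_null_range hT5)[z Ev].
have : S4 *m z = 0.
  apply: ind => [|y yE]; first by rewrite mulmxA mulmxDl ES -[_ *m S4]mulmxA BS mulmx0 addr0 mul0mx.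
  rewrite -mulmxA feedback_mul; last by rewrite mulmxA BS mul0mx.
  by rewrite (mulmxA _ S4) -Ev mulmxA yE mul0mx.
by rewrite Ev -mulmxA => ->; rewrite mulmx0.
Qed.

(** * Construction of feedbacks with prescribed rank *)

(* The completion with E1 = 0 in the basis described at row_block_full. *)
Lemma minimal_completion (C : numClosedFieldType) n m (E : 'M[C]_n) (B : 'M[C]_(n, m)) :
  psdmx E -> \rank B = m ->
  exists (K : 'M_m) (X : 'M_(n, m)), let Q := E + B *m K *m B^t* in
  [/\ psdmx Q, Q *m X = 0, B^t* *m X = 1%:M &
    forall (w : 'cV_n) (u : 'cV_m), E *m w = B *m u -> Q *m w = 0].
Proof.
move=> hE rB; have [EC E0] := hE.
have [k [T hT]] := left_null_basis_exists B.
have TB := left_null_mul hT.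
have BT : B^t* *m T = 0 by rewrite -[T]trmxCK -ctmxM TB ctmx0.
pose G := T^t* *m E *m T.
have GC : G^t* = G by rewrite /G !ctmxM trmxCK EC mulmxA.
have [D ED] : exists D, E *m T = D *m G.
  apply: ker_factor => v Gv; rewrite -mulmxA; apply: psdmx_ker => //.
  have : v^t* *m (G *m v) = 0 by rewrite Gv mulmx0.
  by rewrite /G ctmxM !mulmxA => ->; rewrite mxE.
have TE : T^t* *m E = G *m D^t*.
  by have := congr1 (fun M => M^t*) ED; rewrite (ctmxM E) (ctmxM D) EC GC.
(* [Q] agrees with [E] on the columns of [T] but has only the rank of the compression [G]. Hence
   [Q - E] is killed by [T] on both sides and has the form of a feedback term. *)
pose Q := D *m G *m D^t*.
have QC : Q^t* = Q by rewrite /Q ctmxM (ctmxM D) trmxCK GC mulmxA.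
have QT : Q *m T = E *m T by rewrite /Q -(mulmxA D) -TE -mulmxA -/G ED.
have TQ : T^t* *m Q = T^t* *m E by rewrite -[T^t* *m Q]trmxCK ctmxM trmxCK QC QT ctmxM EC.
have [X0 EQ] : exists X0, Q - E = B *m X0.
  by apply: (left_null_range hT); rewrite mulmxBr TQ subrr.
have [K X0K] : exists K, X0^t* = B *m K.
  apply: (left_null_range hT); have X0T : X0 *m T = 0.
    by apply: (col_free_eq0 rB); rewrite mulmxA -EQ mulmxBl QT subrr.
  by rewrite -ctmxM X0T ctmx0.
have {EQ X0K} QE : E + B *m K^t* *m B^t* = Q.
  have -> : B *m K^t* *m B^t* = Q - E.
    by rewrite EQ -[X0]trmxCK X0K ctmxM mulmxA.
  by rewrite addrC subrK.
have [X1 BX1] : exists X1, B^t* *m X1 = 1%:M.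
  by apply/row_freeP; rewrite /row_free mxrank_ct rB.
(* The right inverse [X1] of [B^t*] is corrected by a term in the range of [T], which [B^t*] kills,
   so as to land in the kernel of [Q]. *)
exists (K^t*), (X1 - T *m D^t* *m X1); rewrite /= QE; split.
- split=> // x; rewrite /Q /G !mulmxA.
  have := E0 (T *m (D^t* *m x)).
  by rewrite !ctmxM trmxCK !mulmxA.
- by rewrite mulmxBr !mulmxA QT ED subrr.
- by rewrite mulmxBr !mulmxA BT !mul0mx subr0.
- by move=> w u Ew; rewrite /Q -(mulmxA D) -TE -!mulmxA Ew (mulmxA _ B) TB mul0mx mulmx0.
Qed.

Lemma row_free_left_null (F : fieldType) p q k (M : 'M[F]_(p, q)) :
  (k + \rank M <= p)%N -> exists2 N : 'M_(k, p), row_free N & N *m M = 0.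
Proof.
move=> le; exists ((pid_mx k : 'M_(k, \rank (kermx M))) *m row_base (kermx M)).
  rewrite /row_free mxrankMfree ?row_base_free // rank_pid_mx //.
  by rewrite mxrank_ker; lia.
rewrite -mulmxA; have -> : row_base (kermx M) *m M = 0; last by rewrite mulmx0.
by apply/sub_kermxP; rewrite eq_row_base.
Qed.

Lemma right_null_rank (C : numClosedFieldType) p q k (M : 'M[C]_(p, q)) (S : 'M_(q, k)) :
  right_null_basis M S -> k = (q - \rank M)%N.
Proof.
move=> [rS MS]; rewrite -(mxrank_ct M); apply: (@left_null_rank _ _ _ _ _ S).
split=> // x; rewrite -MS -ctmxM; split=> [/(congr1 (fun N => N^t*))|->].
  by rewrite trmxCK ctmx0.
by rewrite ctmx0.
Qed.

(* The first argument of maxn provides r = rank [E B] - m at a point where it is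
   not yet known that this is at most the second argument. *)
Lemma admissible_feedback (C : numClosedFieldType) n m (E J R : 'M[C]_n) (B : 'M[C]_(n, m))
    k4 k5 (S4 : 'M_(n, k4)) (T5 : 'M_(n, k5)) r :
  psdmx E -> J = - J^t* -> psdmx R -> \rank B = m ->
  right_null_basis (col_mx E (B^t*)) S4 -> left_null_basis ((J - R) *m S4) T5 ->
  row_block_full E (J - R) B ->
  (\rank (row_mx E B) <= r + m)%N -> (r <= maxn (\rank (row_mx E B) - m) (\rank (T5^t* *m row_mx E B)))%N ->
  exists K FS FH : 'M_m,
    [/\ FS = - FS^t*, FH = FH^t*,
        regular_index_le1 (E + B *m K *m B^t*)
          (J + B *m FS *m B^t* - (R + B *m FH *m B^t*)),
        psdmx (E + B *m K *m B^t*)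
      & psdmx (R + B *m FH *m B^t*)] /\ \rank (E + B *m K *m B^t*)%R = r.
Proof.
move=> hE hJ hR rB hS4 hT5 full le_r ge_r; have [EC _] := hE.
have /eqP := right_null_mul hS4; rewrite mul_col_mx col_mx_eq0 => /andP[/eqP ES /eqP BS].
have full' := row_block_full_dissipative hJ hR full.
have [K0 [X1]] := minimal_completion hE rB; set Q := E + _ => /= -[hQ QX BX EQ].
have [QC _] := hQ.
have XQ : X1^t* *m Q = 0 by rewrite -QC -ctmxM QX ctmx0.
have XB : X1^t* *m B = 1%:M by rewrite -[B]trmxCK -ctmxM BX ctmx1.
have inS4 (x : 'cV_n) : Q *m x = 0 -> B^t* *m x = 0 -> exists z, x = S4 *m z.
  move=> Qx Bx; apply/hS4.2; rewrite mul_col_mx Bx.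
  by have : Q *m x = E *m x; [rewrite mulmxDl -mulmxA Bx mulmx0 addr0|move=> <-; rewrite Qx col_mx0].
have QS : Q *m S4 = 0 by rewrite mulmxDl ES -mulmxA BS mulmx0 addr0.
pose A := J - R.
(* Z spans the kernel of A33 = S4^* A S4; D collects the corresponding columns
   of A13, which the kernel of the completed (1,1) block has to contain. *)
pose Z := (kermx (S4^t* *m A *m S4)^T)^T.
have SZ : S4^t* *m A *m S4 *m Z = 0.
  by apply: trmx_inj; rewrite trmx_mul trmxK mulmx_ker trmx0.
pose D := X1^t* *m A *m S4 *m Z.
(* The columns of [Q] are in the part of the column space of [row_mx E B] killed by [X1^t*], while
   the image under [X1^t*] is everything, of dimension [m]. *)
have rQ : (\rank Q + m)%N = \rank (row_mx E B).
  apply/eqP; rewrite eqn_leq; apply/andP; split; last first.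
    by have := feedback_rank_ge E B (K0 *m B^t*); rewrite mulmxA rB.
  rewrite -(mxrank_tr (row_mx E B)) -(mxrank_mul_ker (row_mx E B)^T (X1^t*)^T) addnC.
  apply: leq_add.
    rewrite -trmx_mul mxrank_tr mul_mx_row XB.
    apply: leq_trans (mxrankM_maxl _ (col_mx 0 1%:M)).
    by rewrite mul_row_col mulmx0 mulmx1 add0r mxrank1.
  rewrite -mxrank_tr; apply: mxrankS; rewrite sub_capmx; apply/andP; split.
    have -> : Q = row_mx E B *m col_mx 1%:M (K0 *m B^t*).
      by rewrite mul_row_col mulmx1 mulmxA.
    by rewrite trmx_mul submxMl.
  by apply/sub_kermxP; rewrite -trmx_mul XQ trmx0.
(* [T5] has rank [\rank (row_mx E B)]. By dissipativity the rows of [(S4 *m Z)^t*] lie in the row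
   space of [T5^t*], and [row_mx E B] kills them; they account for a rank loss of at least
   [\rank D]. *)
have rD : (\rank (T5^t* *m row_mx E B) + \rank D <= \rank (row_mx E B))%N.
  have rAS : \rank (A *m S4) = k4.
    apply/eqP; rewrite eqn_leq rank_leq_col -{1}hS4.1; apply: mxrank_ker_le => v ASv.
    apply: full' => [||w u _]; rewrite ?mulmxA ?ES ?BS ?mul0mx //.
    by rewrite -!mulmxA (mulmxA A) ASv mulmx0.
  have rk5 : k5 = \rank (row_mx E B).
    rewrite (left_null_rank hT5) -/A rAS (right_null_rank hS4).
    have -> : \rank (col_mx E (B^t*)) = \rank (row_mx E B).
      by rewrite -mxrank_ct -[in RHS]EC -[in RHS](trmxCK B) tr_col_mx map_row_mx.
    by rewrite subKn ?rank_leq_row.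
  have <- : \rank (T5^t*) = \rank (row_mx E B) by rewrite mxrank_ct -rk5; case: hT5.
  rewrite -(mxrank_mul_ker (T5^t*) (row_mx E B)) leq_add2l /D -mulmxA.
  apply: leq_trans (mxrankM_maxr _ _) _; rewrite -mxrank_ct; apply: mxrankS.
  rewrite sub_capmx; apply/andP; split.
    apply: (left_null_sub hT5); apply: mulmx_row_eq0 => y.
    pose x := S4 *m Z *m y^t*.
    have SAx : S4^t* *m (A *m x) = 0 by rewrite /x !mulmxA SZ mul0mx.
    have xAx : x^t* *m A *m x = 0.
      by rewrite -mulmxA {1}/x (ctmxM (S4 *m Z)) (ctmxM S4) -!mulmxA SAx !mulmx0.
    have [_ xA] := dissipative_ker hJ hR xAx.
    have -> : y *m ((S4 *m Z)^t* *m (A *m S4)) = x^t* *m A *m S4.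
      by rewrite /x (ctmxM (S4 *m Z)) trmxCK !mulmxA.
    by rewrite xA mulNmx -[_ *m S4]trmxCK (ctmxM _ S4) trmxCK SAx ctmx0 oppr0.
  apply/sub_kermxP; rewrite mul_mx_row -{1}EC -{1}(trmxCK B) -!ctmxM !mulmxA.
  by rewrite ES BS !mul0mx !ctmx0 row_mx0.
have rQr : (\rank Q <= r)%N by rewrite -(leq_add2r m) rQ.
(* [N^t* *m N] is the new (1,1) block: it supplies the missing rank and its kernel contains the
   range of [D]. The bounds [rD] and [rQ] leave enough room in dimension [m]. *)
have [N fN ND] : exists2 N : 'M_(r - \rank Q, m), row_free N & N *m D = 0.
  by apply: row_free_left_null; have := rank_leq_row D; lia.
pose L := N *m B^t*.
have EE : E + B *m (K0 + N^t* *m N) *m B^t* = Q + L^t* *m L.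
  by rewrite /Q /L mulmxDr mulmxDl ctmxM trmxCK !mulmxA addrA.
have hR1 : psdmx (R + B *m 1%:M *m B^t*).
  by have := psdmx_add_gram (B^t*) hR; rewrite trmxCK mulmx1.
exists (K0 + N^t* *m N), 0, 1%:M; rewrite EE; split; last first.
  (* [X1] kills [Q] and is mapped by [L] to [N], so stacking [L] under [Q] adds exactly the rank of
     [N]. *)
  have rcol : \rank (col_mx Q L) = r.
    have := mxrank_mul_ker (col_mx Q L) X1; rewrite mul_col_mx QX -mulmxA BX mulmx1.
    rewrite rank_col_0mx (eqP fN) => eqr.
    apply/eqP; rewrite eqn_leq; apply/andP; split.
      rewrite -addsmxE; apply: leq_trans (mxrank_adds_leqif _ _) _.
      by rewrite -leq_subRL // rank_leq_row.
    rewrite -eqr -{1}(subnK rQr) leq_add2l; apply: mxrankS.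
    by rewrite sub_capmx -addsmxE addsmxSl; apply/sub_kermxP.
  transitivity (\rank (col_mx Q L)); last exact: rcol.
  apply/eqP; rewrite eqn_leq; apply/andP; split; apply: mxrank_ker_le => v.
    rewrite mul_col_mx -[0]col_mx0 => /eq_col_mx[Qv Lv].
    by rewrite mulmxDl Qv -mulmxA Lv mulmx0 addr0.
  move=> Ev; have Lv : L *m v = 0.
    have := congr1 (mulmx (X1^t*)) Ev; rewrite mulmx0 mulmxDl mulmxDr mulmxA XQ mul0mx add0r.
    rewrite -!mulmxA ctmxM trmxCK -mulmxA (mulmxA _ B) XB mul1mx.
    by apply: col_free_eq0; rewrite mxrank_ct (eqP fN).
  by move: Ev; rewrite mul_col_mx mulmxDl -mulmxA Lv mulmx0 addr0 => ->; rewrite col_mx0.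
split=> //; rewrite ?ctmx0 ?oppr0 ?ctmx1 //; last exact: psdmx_add_gram.
apply/regular_index_le1P => x Ex yAx.
have EtC : (Q + L^t* *m L)^t* = Q + L^t* *m L by have [] := psdmx_add_gram L hQ.
have wAx p (w : 'M_(n, p)) : (Q + L^t* *m L) *m w = 0 ->
    w^t* *m ((J + B *m 0 *m B^t* - (R + B *m 1%:M *m B^t*)) *m x) = 0.
  move=> Ew; apply: mulmx_row_eq0 => y; rewrite !mulmxA -(mulmxA _ _ x) mulmxA yAx //.
  by rewrite -mulmxA -EtC -ctmxM Ew ctmx0 mulmx0.
(* Testing [x] against itself puts it in the kernel of [R + B *m B^t*]; this is the effect of
   choosing the identity for [F_H]. *)
have Bx : B^t* *m x = 0.
  have := wAx _ _ Ex; rewrite mulmx0 mul0mx addr0 mulmxA => x0.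
  have [R1x _] := dissipative_ker hJ hR1 x0.
  by apply: (psdmx_add_gram_ker hR); rewrite mulmx1 in R1x; rewrite trmxCK.
rewrite feedback_mul // -/A in wAx.
have Qx : Q *m x = 0.
  by move: Ex; rewrite mulmxDl -!mulmxA Bx !mulmx0 addr0.
have [z xz] := inS4 x Qx Bx.
have S4Ax : S4^t* *m (A *m x) = 0.
  by apply: wAx; rewrite mulmxDl QS -!mulmxA BS !mulmx0 addr0.
have [v zv] : exists v, z = Z *m v.
  have : (z^T <= kermx (S4^t* *m A *m S4)^T)%MS.
    by apply/sub_kermxP; rewrite -trmx_mul -!mulmxA -xz S4Ax trmx0.
  by case/submxP=> v /(congr1 trmx); rewrite trmxK trmx_mul => ->; exists (v^T).
pose phi := X1^t* *m (A *m x).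
have Nphi : N *m phi = 0.
  have -> : phi = D *m v by rewrite /phi /D xz zv !mulmxA.
  by rewrite mulmxA ND mul0mx.
(* Since [N] kills [phi], the vector [X1 *m phi] is in the kernel of the completed [E]; testing with
   it yields the squared norm of [phi]. *)
have phi0 : phi = 0.
  apply: ctmx_self_eq0; rewrite {2}/phi mulmxA -ctmxM wAx ?mxE //.
  have LX : L *m X1 = N by rewrite /L -mulmxA BX mulmx1.
  by rewrite mulmxDl (mulmxA Q) QX mul0mx add0r -(mulmxA _ L) (mulmxA L) LX Nphi mulmx0.
apply: full' => // [|w u Ew]; first by rewrite xz mulmxA ES mul0mx.
(* Any [w] allowed in [full'] splits into a part in the range of [X1], tested by [phi], and a part
   in the range of [S4]. *)
have [z' ez'] : exists z', w - X1 *m (B^t* *m w) = S4 *m z'.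
  apply: inS4; first by rewrite mulmxBr (EQ _ _ Ew) (mulmxA Q) QX mul0mx subr0.
  by rewrite mulmxBr (mulmxA _ X1) BX mul1mx subrr.
have -> : w = X1 *m (B^t* *m w) + S4 *m z' by rewrite -ez' addrC subrK.
rewrite -mulmxA ctmxD mulmxDl (ctmxM X1) (ctmxM S4) -!(mulmxA _ _ (A *m x)).
by rewrite -/phi phi0 S4Ax !mulmx0 addr0.
Qed.

(** * Solvability and the attainable ranks *)

Theorem theorem13 (RR : realType) (n m : nat)
    (E J R : 'M[RR[i]]_n) (B : 'M[RR[i]]_(n, m))
    (hE : psdmx E) (hR : psdmx R) (hJ : J = - J ^t*) (hB : \rank B = m)
    (* T1 = T_oo(B), T2 = T_oo([E B]), S3 = S_oo(T2^H (J - R)) *)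
    (k1 k2 k3 : nat)
    (T1 : 'M[RR[i]]_(n, k1)) (hT1 : left_null_basis B T1)
    (T2 : 'M[RR[i]]_(n, k2)) (hT2 : left_null_basis (row_mx E B) T2)
    (S3 : 'M[RR[i]]_(n, k3)) (hS3 : right_null_basis (T2 ^t* *m (J - R)) S3)
    (* S4 = S_oo([E; B^H]), T5 = T_oo((J - R) S4) *)
    (k4 k5 : nat)
    (S4 : 'M[RR[i]]_(n, k4)) (hS4 : right_null_basis (col_mx E (B ^t*)) S4)
    (T5 : 'M[RR[i]]_(n, k5)) (hT5 : left_null_basis ((J - R) *m S4) T5) :
  let condA := \rank (row_mx (row_mx E (J - R)) B) = n in
  let condB :=
    (\rank (T1 ^t* *m E *m S3))%:Z
      = (\rank (row_mx E B))%:Z - (\rank B)%:Z in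
  let admissible (K FS FH : 'M[RR[i]]_m) :=
    [/\ FS = - FS ^t*, FH = FH ^t*,
        regular_index_le1 (E + B *m K *m B ^t*)
          (J + B *m FS *m B ^t* - (R + B *m FH *m B ^t*)),
        psdmx (E + B *m K *m B ^t*)
      & psdmx (R + B *m FH *m B ^t*)] in
  ((exists K FS FH : 'M[RR[i]]_m, admissible K FS FH) <-> condA /\ condB)
  /\
  (condA /\ condB ->
   forall r : int,
     (exists K FS FH : 'M[RR[i]]_m,
        admissible K FS FH /\ (\rank (E + B *m K *m B ^t*)%R)%:Z = r)
     <->
     (\rank (row_mx E B))%:Z - (\rank B)%:Z <= r
       <= (\rank (T5 ^t* *m row_mx E B))%:Z).
Proof.
move=> condA condB admissible.
have [EC _] := hE.
have fullP : condA /\ condB <-> row_block_full E (J - R) B.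
  have [to from] := row_block_fullP EC hT1 hT2 hS3.
  split=> [[cA cB]|/to[cA cB]]; last by split; rewrite // /condB -cB PoszD addrK.
  by apply: from; split=> //; apply/eqP; rewrite -eqz_nat PoszD cB subrK.
have nec K FS FH : admissible K FS FH -> row_block_full E (J - R) B.
  by case=> _ _ ind psdE _; apply: row_block_full_necessary ind.
have suf r : row_block_full E (J - R) B -> (\rank (row_mx E B) <= r + m)%N ->
    (r <= maxn (\rank (row_mx E B) - m) (\rank (T5^t* *m row_mx E B)))%N ->
    exists K FS FH, admissible K FS FH /\ \rank (E + B *m K *m B^t*)%R = r.
  move=> full le_r ge_r.
  exact: (admissible_feedback hE hJ hR hB hS4 hT5).
(* An integer [r] in the stated range is nonnegative because [\rank (row_mx E B)] is at least [m],
   so it can be treated as a natural number. *)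
have arith (e d : nat) (z : int) : (m <= e)%N -> e%:Z - m%:Z <= z <= d%:Z ->
    exists q : nat, [/\ z = q, (e <= q + m)%N & (q <= d)%N].
  by case: z => q le_me le_z; [exists q; split=> //; lia | lia].
have le_rank : (m <= \rank (row_mx E B))%N.
  have eB : B = row_mx E B *m col_mx 0 1%:M by rewrite mul_row_col mulmx0 mulmx1 add0r.
  by rewrite -{1}hB {1}eB mxrankM_maxl.
split.
  split=> [[K [FS [FH /nec]]]|/fullP full]; first by move/fullP.
  have [||K [FS [FH [adm _]]]] := suf (\rank (row_mx E B) - m)%N full.
  - by rewrite (subnK le_rank).
  - by rewrite leq_maxl.
  by exists K, FS, FH.
move=> /fullP full r; rewrite hB; split=> [[K [FS [FH [adm <-]]]]|].
  have [_ _ ind _ _] := adm; have le := feedback_rank_le hS4 hT5 ind.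
  have ge := feedback_rank_ge E B (K *m B^t*); rewrite mulmxA hB in ge.
  by rewrite lerBlDr -PoszD !lez_nat ge.
case/(arith _ _ _ le_rank)=> q [-> le_q ge_q].
have [//||K [FS [FH [adm rE]]]] := suf q full; first by rewrite leq_max ge_q orbT.
by exists K, FS, FH; rewrite rE.
Qed.
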